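(* Let $J\subset\bar P$ be an $L$-ideal which contains $D$, and let $J'=\mathrm{Sat}_L(J)$ be its $L$-saturation. Let $G$ be a Gröbner $L$-basis of $J$ modulo $D$. Then $G'=\psi(G)^*=\{\psi(g)^*\mid g\in G\}$ is a Gröbner $L$-basis of $J'$ modulo $D$.
   Context: $K$ is a field, $X=\{x_1,x_2,\ldots\}$ a finite or countable set of variables, $t$ a new variable, $\bar X=X\cup\{t\}$, $\bar F=K\langle\bar X\rangle$ the free associative algebra. $\mathbb N=\{0,1,\ldots\}$, $\mathbb N^*=\mathbb N\setminus\{0\}$. $P=K[X\times\mathbb N^*]\subset\bar P=K[\bar X\times\mathbb N^*]$ are commutative polynomial algebras, with variables written $x_i(j)$, $t(j)$ ($i,j\ge1$). $\mathbb N$ acts by algebra endomorphisms $k\cdot x_i(j)=x_i(k+j)$, $k\cdot t(j)=t(k+j)$. An ideal $J$ is an $\mathbb N$-ideal if $\mathbb N\cdot J\subset J$; $\langle S\rangle_{\mathbb N}$ is the $\mathbb N$-ideal generated by $S$; an $\mathbb N$-basis of $J$ is a set $S$ with $J=\langle S\rangle_{\mathbb N}$. The multidegree of a monomial is $\mu=(\mu_k)_{k\ge1}$, where $\mu_k$ is the number of its variables (with multiplicity) of place index $k$. $\bar\iota:\bar F\to\bar P$ is the $K$-linear embedding $y_1\cdots y_d\mapsto y_1(1)\cdots y_d(d)$ ($y_k\in\bar X$); $\bar V_d$ is the image of the degree-$d$ component, and $\bar L=\bigcup_d\bar V_d$ (multilinear elements). An $\mathbb N$-ideal $J\subset\bar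 P$ is an $L$-ideal if $J=\langle J\cap\bar L\rangle_{\mathbb N}$. $D$ is the $\mathbb N$-ideal generated by the elements $\bar\iota([t,x_i])=t(1)x_i(2)-x_i(1)t(2)$, $i\ge1$. For an $L$-ideal $J\supset D$, $\mathrm{Sat}_L(J)=\langle f\in\bar L\mid \prod_{d<k\le d'}t(k)\,f\in J\text{ for some }d'\ge d=\deg(f)\rangle_{\mathbb N}$; it is an $L$-ideal containing $J$. $\psi:\bar P\to\bar P$ is the algebra endomorphism with $x_i(j)\mapsto x_i(j)$, $t(j)\mapsto1$; its image is $P$. For $0\ne f=\sum_\mu f_\mu\in P$ (multihomogeneous components), put $\nu_k=\max_\mu\{\mu_k\}$ (over $\mu$ with $f_\mu\neq0$) and $f^*=\sum_\mu f_\mu\prod_k t(k)^{\nu_k-\mu_k}$. Ordering: $\bar P$ carries a place $\mathbb N$-ordering induced by a monomial ordering $\prec$ of $\bar P(1)=K[t(1),x_i(1)\mid i\ge1]$ with $t(1)\prec x_1(1)\prec x_2(1)\prec\cdots$. That is, $\prec$ is transported to each $\bar P(j)=K[t(j),x_i(j)\mid i\ge1]$ by the shift, and for monomials written $m=m_{j_1}\cdots m_{j_k}$, $n=n_{j_1}\cdots n_{j_k}$ with $j_1>\cdots>j_k$ and $m_{j_s},n_{j_s}$ (possibly trivial) monomials of $\bar P(j_s)$, one sets $m\prec n$ iff for some $r$ one has $m_{j_s}=n_{j_s}$ for all $s<r$ and $m_{j_r}\prec n_{j_r}$. $\mathrm{lm}$ denotes leading monomial of nonzero elements. For an $L$-ideal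 $J$, a subset $G\subset J\cap\bar L$ is a Gröbner $L$-basis of $J$ if for every nonzero $f\in J\cap\bar L$ there are $0\neq g\in G$, $i\ge0$ such that $i\cdot\mathrm{lm}(g)$ divides $\mathrm{lm}(f)$. An element $f\in\bar L$ is in normal form modulo $D$ if none of its monomials is divisible by a shift $k\cdot(t(1)x_i(2))$, $k\ge0,i\ge1$ (these being the shifts of the leading monomials of the elements $\bar\iota([t,x_i])$). For an $L$-ideal $J\supset D$, a set $G\subset J\cap\bar L$ of elements in normal form modulo $D$ is a Gröbner $L$-basis of $J$ modulo $D$ if $G\cup\{\bar\iota([t,x_i])\mid i\ge1\}$ is a Gröbner $L$-basis of $J$. *)

(* Defs.v *)
From HB Require Import structures.
From mathcomp Require Import all_boot all_algebra finmap.
From mathcomp.multinomials Require Import monalg.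

Set Implicit Arguments.
Unset Strict Implicit.
Unset Printing Implicit Defensive.

Import GRing.Theory.
Local Open Scope fset_scope.
Local Open Scope ring_scope.

(* Conventions. X = {x_1, ..., x_n} when N = Some n, and X is countably
   infinite when N = None. All indices are 0-based: the index i of xvar stands
   for x_(i+1), and the place j : nat stands for the place j+1 of N^*, so that
   (Some i, j) is x_(i+1)(j+1) and (None, j) is t(j+1). *)

Definition xbound (N : option nat) (i : nat) : bool :=
  if N is Some n then (i < n)%N else true.

Definition xvar (N : option nat) := {i : nat | xbound N i}.

(* None is the extra variable t. *)
Definition xbar (N : option nat) := option (xvar N).

Definition lpvar (N : option nat) := (xbar N * nat)%type.

Notation Fbar K N := {malg K[{fmonom xbar N}]}.
Notation Pbar K N := {malg K[{cmonom lpvar N}]}.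

Section Letterplace.
Context (K : fieldType) (N : option nat).

Local Notation P := (Pbar K N).
Local Notation mon := {cmonom lpvar N}.

Implicit Types (f g h : P) (m n : mon) (J S G : P -> Prop).

Definition fvar (y : xbar N) : Fbar K N := << fmu y >>.
Definition var (v : lpvar N) : P := << ucm v >>.
Definition tvar (j : nat) : P := var (None, j).

(* The K-algebra endomorphism of P sending each variable v to phi v. *)
Definition subst (phi : lpvar N -> P) : P -> P :=
  mmap malgC (fun m => \prod_(v <- finsupp m) phi v ^+ m v).

Definition shift (k : nat) : P -> P :=
  subst (fun v => var (v.1, (k + v.2)%N)).

Definition psi : P -> P :=
  subst (fun v => if v.1 is Some _ then var v else 1).

Definition shiftm (k : nat) (m : mon) : mon :=
  \big[mmul/mone]_(v <- finsupp m) expcmn (ucm (v.1, (k + v.2)%N)) (m v).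

Definition mdvd (m n : mon) : Prop := exists m', n = mmul m m'.

(* Ideals *)

Definition is_ideal J : Prop :=
  [/\ J 0, (forall f g, J f -> J g -> J (f + g))
    & (forall f g, J g -> J (f * g))].

Definition is_Nideal J : Prop :=
  is_ideal J /\ (forall k f, J f -> J (shift k f)).

Definition Ngen S : P -> Prop := fun f =>
  forall J, is_Nideal J -> (forall g, S g -> J g) -> J f.

(* The letterplace embedding y_1 ... y_d |-> y_1(1) ... y_d(d) *)

Definition embed : Fbar K N -> P :=
  mmap malgC
       (fun w : {fmonom xbar N} =>
          \prod_(v <- zip w (iota 0 (size w))) var v).

Definition homog (d : nat) (a : Fbar K N) : Prop :=
  forall w, w \in msupp a -> fdeg w = d.

Definition Vbar (d : nat) : P -> Prop := fun f =>
  exists2 a, homog d a & f = embed a.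

Definition Lbar : P -> Prop := fun f => exists d, Vbar d f.

Definition is_Lideal J : Prop :=
  is_Nideal J /\ (forall f, J f <-> Ngen (fun g => J g /\ Lbar g) f).

Definition tcomm (i : xvar N) : P :=
  embed (fvar None * fvar (Some i) - fvar (Some i) * fvar None).

Definition Dgens : P -> Prop := fun f => exists i, f = tcomm i.

Definition D : P -> Prop := Ngen Dgens.

(* A nonzero element of Vbar d has degree d, so quantifying over d such that f
   is in Vbar d amounts to taking d = deg f. With 0-based places, the product
   of the t(k) for d < k <= d' runs over d <= k < d'. *)
Definition SatL J : P -> Prop :=
  Ngen (fun f => exists d d',
    [/\ Vbar d f, (d <= d')%N & J (\prod_(d <= k < d') tvar k * f)]).

(* Multidegrees and the operation f |-> f^* *)

Definition multideg (m : mon) : {cmonom nat} :=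
  [cmonom \sum_(v <- finsupp m | v.2 == k) m v
     | k in [fset v.2 | v in finsupp m]]%M.

Definition multidegs f : {fset {cmonom nat}} :=
  [fset multideg m | m in msupp f].

Definition mhcomp f (mu : {cmonom nat}) : P :=
  \sum_(m <- msupp f | multideg m == mu) << f@_m *g m >>.

Definition numax f (k : nat) : nat := (\max_(mu <- multidegs f) mu k)%N.

(* The product is over the finitely many places occurring in f; the exponent is
   zero at all other places. By convention 0^* = 0. *)
Definition star f : P :=
  \sum_(mu <- multidegs f)
    mhcomp f mu *
    \prod_(k <- \bigcup_(eta <- multidegs f) finsupp eta)
       tvar k ^+ (numax f k - mu k).

End Letterplace.

Section Ordering.
Context (N : option nat).
Local Notation mon := {cmonom lpvar N}.

(* The monomials of the polynomial algebra at any single place are identified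
   with {cmonom xbar N}; this identification carries out the transport of the
   ordering from the first place to all the others. *)

Record monomial_ordering (lt : rel {cmonom xbar N}) : Prop := MonomialOrdering {
  mo_irr : irreflexive lt;
  mo_trans : transitive lt;
  mo_total : forall a b, a != b -> lt a b || lt b a;
  mo_mul : forall a b c, lt a b -> lt (mmul c a) (mmul c b);
  mo_wf : well_founded (fun a b => lt a b)
}.

Definition var_increasing (lt : rel {cmonom xbar N}) : Prop :=
  (forall i : xvar N, lt (ucm None) (ucm (Some i))) /\
  (forall i j : xvar N, (val i < val j)%N ->
     lt (ucm (Some i)) (ucm (Some j))).

Definition slice (m : mon) (j : nat) : {cmonom xbar N} :=
  [cmonom m (y, j) | y in [fset v.1 | v in finsupp m]]%M.

(* Only the places occurring in m or n matter: at all other places both slices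
   are trivial. *)
Definition place_lt (lt : rel {cmonom xbar N}) : rel mon := fun m n =>
  let places := [fset v.2 | v in finsupp m] `|` [fset v.2 | v in finsupp n] in
  has (fun j => lt (slice m j) (slice n j) &&
         all (fun k => (j < k)%N ==> (slice m k == slice n k)) places) places.

(* The leading monomial of f != 0; the trivial monomial, which is the least
   one, when f = 0. *)
Definition lm (K : fieldType) (lt : rel {cmonom xbar N}) (f : Pbar K N) : mon :=
  foldr (fun m n => if place_lt lt n m then m else n) mone (msupp f).

End Ordering.

Section Groebner.
Context (K : fieldType) (N : option nat) (lt : rel {cmonom xbar N}).
Implicit Types (J G : Pbar K N -> Prop).

Definition is_groebner J G : Prop :=
  (forall g, G g -> J g /\ Lbar g) /\
  (forall f, J f -> Lbar f -> f != 0 ->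
     exists g i, [/\ G g, g != 0 & mdvd (shiftm i (lm lt g)) (lm lt f)]).

(* No monomial is divisible by a shift of t(1) x_i(2). *)
Definition normal_modD (f : Pbar K N) : Prop :=
  forall m, m \in msupp f ->
  forall (k : nat) (i : xvar N),
    ~ mdvd (shiftm k (mmul (ucm (None, 0%N)) (ucm (Some i, 1%N)))) m.

Definition is_groebner_modD J G : Prop :=
  (forall g, G g -> [/\ J g, Lbar g & normal_modD g]) /\
  is_groebner J (fun g => G g \/ Dgens g).

End Groebner.

(* Main.v *)
From HB Require Import structures.
Require Import Defs.
From mathcomp Require Import all_boot all_algebra finmap.
From mathcomp.multinomials Require Import monalg.
From mathcomp Require Import zify.

(**
   The operation [psi g |-> star (psi g)] undoes the multiplication by t. If g
   is in normal form modulo D, each of its words consists of letters of X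
   followed by t's; let d be the degree of g and c the maximal number of letters
   of X in one of its words. Then star (psi g) is the g' such that g =
   t(c+1)...t(d) g' ([star_psi_normal]). Hence g' is one of the generators of
   the saturation, it is again in normal form, and if g is not zero at least one
   of the words of g', of length c, consists only of letters of X. As t is
   smaller than every x_i and the last place is compared first, the leading
   monomial of g' is such a word ([lm_padded]).

   The main point is that every multilinear element f of degree d of the
   saturation, and not only its generators, satisfies t(d+1)...t(d+e) f in J for
   some e ([SatL_Vbar]). Seen in the free algebra, f is a sum of terms a h b with
   words a, b and generators h, such that h followed by a power of t lies in J; as
   J contains D, the power of t to the right of a h b may be moved to the left of
   b. In the commutative algebra the factors a h b are found by projecting
   multiples of shifts of h to the multidegree (1, ..., 1, 0, ...). The elements
   whose multiples and shifts all have a projection that is absorbed by J after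
   multiplication by t's form an N-ideal that contains the generators, hence the
   whole saturation.

   Now let f be as above and nonzero. The leading monomial of t(d+1)...t(d+e) f is
   that of f times t(d+1)...t(d+e), and it is divisible by a shift of the leading
   monomial of a commutator or of some g in G. In the first case this shift of
   t(1)x_i(2) already divides the leading monomial of f, since the appended t's
   come after all letters of f ([mdvd_tx_cancel]). In the second case the leading
   monomial of star (psi g) divides that of g and contains no t; therefore its
   shift divides the leading monomial of f ([mdvd_Xword_cancel]).
*)

Set Implicit Arguments.
Unset Strict Implicit.
Unset Printing Implicit Defensive.

Import GRing.Theory.
Local Open Scope fset_scope.
Local Open Scope ring_scope.

Local Notation "1" := (@mone _) : monom_scope.
Local Notation "x * y" := (mmul x y) : monom_scope.

(** * Commutative monomials *)

Section Cmonom.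
Context (I : choiceType).
Implicit Types (m n u : {cmonom I}) (i : I).

Lemma ucm_dvd m i : m i != 0%N -> exists m', m = (ucm i * m')%M.
Proof.
move=> mi; exists (divcm m (ucm i)); apply/eqP/cmP=> j.
rewrite cmM divcmE !cmU; have [<-|] := eqVneq i j; last by rewrite subn0.
by rewrite subnKC // lt0n.
Qed.

Lemma cmonom_ind (Q : {cmonom I} -> Prop) :
  Q 1%M -> (forall i m, Q m -> Q (ucm i * m)%M) -> forall m, Q m.
Proof.
move=> Q1 QM m; have [n] := ubnP (mdeg m); elim: n m => // n IH m le_mn.
have [/eqP|] := eqVneq (mdeg m) 0%N; first by rewrite mdeg_eq0 => /eqP->.
rewrite mdegE sum_nat_seq_neq0 => /hasP[i _ /= /ucm_dvd[m' Em]].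
by rewrite Em; apply/QM/IH; move: le_mn; rewrite Em mdegM mdegU.
Qed.

Lemma mulm_inj m : injective (mmul m).
Proof.
move=> a b /eqP/cmP eq_mm; apply/eqP/cmP=> i.
by have := eq_mm i; rewrite !cmM => /addnI.
Qed.

Lemma expcmnE m k i : expcmn m k i = (k * m i)%N.
Proof.
rewrite /expcmn; case: k => [|k]; first by rewrite onecmE.
rewrite iteropS; elim: k => [|k IH]; first by rewrite mul1n.
by rewrite iterS mulcmE IH mulSn.
Qed.

(** A sum or product over the support of a monomial is a monoid morphism as soon
    as each factor is one in the exponent: both supports can be enlarged to that
    of the product. This covers multidegrees, shifts and substitutions. *)
Lemma big_cmonomM (R : Type) (idx : R) (op : Monoid.com_law idx)
    (F : I -> nat -> R) m n :
    (forall i, F i 0%N = idx) ->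
    (forall i a b, F i (a + b)%N = op (F i a) (F i b)) ->
  \big[op/idx]_(i <- finsupp (m * n)%M) F i ((m * n)%M i) =
  op (\big[op/idx]_(i <- finsupp m) F i (m i))
     (\big[op/idx]_(i <- finsupp n) F i (n i)).
Proof.
move=> F0 FD; rewrite mdomD.
rewrite (big_fset_incl op (fsubsetUl (finsupp m) (finsupp n))); last first.
  by move=> i _; rewrite -cmE_neq0 negbK => /eqP->.
rewrite (big_fset_incl op (fsubsetUr (finsupp m) (finsupp n))); last first.
  by move=> i _; rewrite -cmE_neq0 negbK => /eqP->.
by rewrite -big_split /=; apply: eq_bigr => i _; rewrite cmM FD.
Qed.

End Cmonom.

(** * Letterplace monomials *)

(** Locked, so that distinct monomials are never compared by unfolding the
    monoid algebra. *)
HB.lock Definition mono (K : fieldType) (N : option nat) (m : {cmonom lpvar N})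
  : Pbar K N := << m >>.
Arguments mono K {N} m.

Section Letterplace.
Context (K : fieldType) (N : option nat).

Local Notation P := (Pbar K N).
Local Notation mon := {cmonom lpvar N}.
Implicit Types (f g h : P) (m n u : mon) (w : seq (xbar N)) (J : P -> Prop).

Lemma mdvdP m n : mdvd m n <-> forall v, (m v <= n v)%N.
Proof.
split=> [[m' ->] v|le_mn]; first by rewrite cmM leq_addr.
by exists (divcm n m); apply/eqP/cmP=> v; rewrite cmM divcmE subnKC.
Qed.

Lemma multidegE m k : multideg m k = (\sum_(v <- finsupp m | v.2 == k) m v)%N.
Proof.
rewrite /multideg cmE fsfunE; case: ifPn => // kP.
rewrite big_seq_cond big1 // => v /andP[vm /eqP vk].
by case/negP: kP; apply/imfsetP; exists v.
Qed.

Lemma multideg1 : multideg (1 : mon)%M = 1%M.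
Proof. by apply/eqP/cmP=> k; rewrite multidegE mdom1 big_nil cm1. Qed.

Lemma multidegU (v : lpvar N) : multideg (ucm v) = ucm v.2.
Proof.
apply/eqP/cmP=> k; rewrite multidegE mdomU big_mkcond big_seq_fset1.
by rewrite cmUU cmU; case: eqP.
Qed.

Lemma multidegM m n : multideg (m * n)%M = (multideg m * multideg n)%M.
Proof.
apply/eqP/cmP=> k; rewrite cmM !multidegE ![in LHS]big_mkcond.
rewrite (big_cmonomM (F := fun v : lpvar N => fun a => if v.2 == k then a else 0%N)) /=.
- by rewrite -!big_mkcond.
- by move=> v; case: ifP.
- by move=> v a b; case: ifP.
Qed.

Lemma multideg_gt0 m k : (0 < multideg m k)%N -> exists y m', m = (ucm (y, k) * m')%M.
Proof.
rewrite multidegE lt0n big_mkcond sum_nat_seq_neq0 => /hasP[[y j] _ /=].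
have [->|_] := eqVneq j k; last by rewrite eqxx.
by case/ucm_dvd=> m' ->; exists y, m'.
Qed.

(** The word w read from the place k on; the letterplace embedding is the case
    k = 0. An arbitrary starting place allows inductions on w and describes the
    shifts of embedded words. *)
Fixpoint wordmon (k : nat) (w : seq (xbar N)) : mon :=
  if w is y :: w' then (ucm (y, k) * wordmon k.+1 w')%M else 1%M.

Definition tmon (k n : nat) : mon := wordmon k (nseq n None).

Lemma tmonS k (e : nat) : tmon k e.+1 = (ucm (None, k) * tmon k.+1 e)%M.
Proof. by []. Qed.

Definition Xword (xs : seq (xvar N)) : mon := wordmon 0 (map some xs).

Lemma wordmon_cat k w1 w2 :
  wordmon k (w1 ++ w2) = (wordmon k w1 * wordmon (k + size w1) w2)%M.
Proof.
elim: w1 k => [|y w1 IH] k /=; first by rewrite mul1m addn0.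
by rewrite IH mulmA addSnnS.
Qed.

Lemma tmonD k a b : tmon k (a + b) = (tmon k a * tmon (k + a) b)%M.
Proof. by rewrite /tmon nseqD wordmon_cat size_nseq. Qed.

Lemma multideg_wordmon k w : multideg (wordmon k w) = multideg (tmon k (size w)).
Proof.
elim: w k => //= y w IH k; rewrite multidegM multidegU IH.
by rewrite /tmon /= multidegM multidegU.
Qed.

Lemma multideg_tmon k (n : nat) j : multideg (tmon k n) j = (k <= j < k + n)%N.
Proof.
elim: n k => [|n IH] k; first by rewrite /tmon /= multideg1 cm1; lia.
by rewrite /tmon /= multidegM multidegU cmM IH cmU /=; lia.
Qed.

Lemma wordmonE k w y j :
  wordmon k w (y, j) = ((k <= j)%N && (ohead (drop (j - k) w) == Some y)) :> nat.
Proof.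
elim: w k => [|z w IH] k /=; first by rewrite cm1 andbF.
rewrite cmM cmU IH xpair_eqE.
have [<-|ne_kj] := eqVneq k j.
  by rewrite ltnn leqnn subnn drop0 andbT addn0 /= (inj_eq Some_inj).
rewrite andbF add0n ltn_neqAle ne_kj /=.
have [le_kj|//] := leqP k j.
by rewrite -[(j - k)%N]prednK ?subn_gt0 ?ltn_neqAle ?ne_kj //= subnS.
Qed.

Lemma tmon_Some k (n : nat) x j : tmon k n (Some x, j) = 0%N.
Proof.
elim: n k => [|n IH] k; first by rewrite cm1.
by rewrite /tmon /= cmM cmU IH.
Qed.

(** A monomial that meets each place of an interval contains one variable at each
    of them, and these variables form a word. This recovers the free algebra
    inside the commutative one: the part of a monomial that lies to the right of
    a shifted generator is a word. *)
Lemma wordmon_dvd m a (n : nat) :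
    (forall j, a <= j < a + n -> 0 < multideg m j)%N ->
  exists u w, size w = n /\ m = (u * wordmon a w)%M.
Proof.
elim: n a m => [|n IH] a m m_gt0.
  by exists m, [::]; rewrite mulm1.
have [|y [m' Em]] := @multideg_gt0 m a; first by apply: m_gt0; lia.
have [|u [w [sw Em']]] := IH a.+1 m'.
  move=> j lej; have := m_gt0 j; rewrite Em multidegM multidegU cmM cmU /=; lia.
exists u, (y :: w); rewrite /= sw; split=> //.
by rewrite Em Em' !mulmA [in LHS](mulmC _ u).
Qed.

(** The monomials of the letterplace space of degree d, recognised by their
    multidegree (1, ..., 1, 0, 0, ...). *)
Definition mlin (d : nat) : pred mon :=
  fun m => multideg m == multideg (tmon 0 d).

Lemma mdeg_wordmon k w : mdeg (wordmon k w) = size w.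
Proof. by elim: w k => [|y w IH] k /=; rewrite ?mdeg1 // mdegM mdegU IH. Qed.

Lemma mlinP d m : reflect (exists2 w, size w = d & m = wordmon 0 w) (mlin d m).
Proof.
apply: (iffP eqP) => [Em|[w <- ->]]; last exact: multideg_wordmon.
have [|u [w [sw Emw]]] := @wordmon_dvd m 0 d.
  by move=> j ltj; rewrite Em multideg_tmon; lia.
exists w => //; have u1 : multideg u = 1%M.
  apply: (@mulm_inj _ (multideg (wordmon 0 w))).
  by rewrite mulm1 mulmC -multidegM -Emw Em multideg_wordmon sw.
suff u_1 : u = 1%M by rewrite Emw u_1 mul1m.
apply/eqP; rewrite -mdeg_eq0; apply: contraT; rewrite mdegE sum_nat_seq_neq0.
case/hasP=> -[y j] _ /= /ucm_dvd[u' Eu]; have := cm1 j.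
by rewrite -u1 Eu multidegM multidegU cmM cmU eqxx.
Qed.

(** * Monomials as polynomials, substitutions and shifts *)

Local Notation "''X[' m ]" := (mono K m) (at level 0, format "''X[' m ]").

Lemma monoE m : 'X[m] = << m >>.
Proof. by rewrite unlock. Qed.

Lemma monoM m n : 'X[(m * n)%M] = 'X[m] * 'X[n].
Proof. by rewrite !monoE malgM_def fgmulUU mulr1. Qed.

Lemma mono1 : 'X[1%M : mon] = 1.
Proof. by rewrite monoE. Qed.

Lemma monoMA m n h : 'X[(m * n)%M] * h = 'X[m] * ('X[n] * h).
Proof. by rewrite monoM -mulrA. Qed.

Lemma monoMCA a u b h : 'X[a] * ('X[(u * b)%M] * h) = 'X[u] * ('X[(b * a)%M] * h).
Proof.
suff gen (R : comNzRingType) (a' u' b' ub ba h' : R) :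
    ub = u' * b' -> ba = b' * a' -> a' * (ub * h') = u' * (ba * h').
  exact: gen (monoM u b) (monoM b a).
by move=> -> ->; rewrite -!mulrA mulrCA (mulrCA b').
Qed.

Lemma malgU_scale (c : K) m : << c *g m >> = c *: 'X[m] :> P.
Proof. by rewrite monoE -[RHS]mul_malgC malgM_def fgmulUU mulr1 mul1m. Qed.

Lemma malg_sum f : f = \sum_(m <- msupp f) f@_m *: 'X[m].
Proof. by rewrite {1}[f]monalgE; apply: eq_bigr => m _; rewrite malgU_scale. Qed.

Lemma mcoeff_mono m n : 'X[m]@_n = (m == n)%:R.
Proof. by rewrite monoE mcoeffU1. Qed.

Lemma msupp_mono m : msupp 'X[m] = [fset m].
Proof. by rewrite monoE msuppU1. Qed.

Lemma msupp_mono_eq m n : n \in msupp 'X[m] -> n = m.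
Proof. by rewrite msupp_mono in_fset1 => /eqP. Qed.

Section LinearExtension.
Context (M : choiceType) (h : M -> P).
Implicit Types (a : {malg K[M]}).

Lemma mmapCE a : mmap malgC h a = \sum_(m <- msupp a) a@_m *: h m.
Proof. by rewrite mmapE; apply: eq_bigr => m _; rewrite mul_malgC. Qed.

Lemma mmapCZ c a : mmap malgC h (c *: a) = c *: mmap malgC h a.
Proof.
rewrite (mmapEw (msuppZ_le c a)) mmapE scaler_sumr.
apply: eq_bigr => m _; rewrite /= mcoeffZ mpolyCM -[LHS]mulrA.
exact: mul_malgC.
Qed.

Lemma mmapCU (x : M) : mmap malgC h << x >> = h x.
Proof. by rewrite mmapU /= mpolyC1E mul1r. Qed.

End LinearExtension.

Lemma mmapC_mono (h : mon -> P) m : mmap malgC h 'X[m] = h m.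
Proof. by rewrite monoE mmapCU. Qed.

Lemma varE (v : lpvar N) : var K v = 'X[ucm v].
Proof. by rewrite monoE. Qed.

Section Subst.
Context (phi : lpvar N -> P).

Definition monsubst m : P := \prod_(v <- finsupp m) phi v ^+ m v.

Lemma monsubst_mmorphism : mmorphism monsubst.
Proof.
split=> [m n|]; last by rewrite /monsubst mdom1 big_nil.
apply: (big_cmonomM (F := fun v a => phi v ^+ a)) => // v a b.
by rewrite exprD.
Qed.

HB.instance Definition _ :=
  monalg.isMultiplicative.Build mon P monsubst monsubst_mmorphism.

Lemma substE f : subst phi f = mmap malgC monsubst f.
Proof. by []. Qed.

Lemma substM f g : subst phi (f * g) = subst phi f * subst phi g.
Proof. by rewrite substE rmorphM. Qed.

Lemma subst1 : subst phi 1 = 1.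
Proof. by rewrite substE rmorph1. Qed.

Lemma subst_var v : subst phi (var K v) = phi v.
Proof.
by rewrite varE substE [LHS]mmapC_mono /monsubst mdomU big_seq_fset1 cmUU expr1.
Qed.

End Subst.

Lemma shiftmM k m n : shiftm k (m * n)%M = (shiftm k m * shiftm k n)%M.
Proof.
apply: (big_cmonomM (F := fun v : lpvar N => expcmn (ucm (v.1, (k + v.2)%N)))) => // v a b.
by apply/eqP/cmP=> i; rewrite cmM !expcmnE mulnDl.
Qed.

Lemma shiftm1 k : shiftm k (1 : mon)%M = 1%M.
Proof. by rewrite /shiftm mdom1 big_nil. Qed.

Lemma shiftmU k y j : shiftm k (ucm (y, j) : mon) = ucm (y, (k + j)%N).
Proof. by rewrite /shiftm mdomU big_seq_fset1 cmUU. Qed.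

Lemma shiftm_wordmon k j w : shiftm k (wordmon j w) = wordmon (k + j) w.
Proof.
elim: w j => [|y w IH] j; first exact: shiftm1.
by rewrite /= shiftmM shiftmU IH addnS.
Qed.

Lemma shiftm_tmon k j e : shiftm k (tmon j e) = tmon (k + j) e.
Proof. exact: shiftm_wordmon. Qed.

Lemma shift_add k f g : shift k (f + g) = shift k f + shift k g.
Proof. exact: raddfD. Qed.

Lemma shiftB k f g : shift k (f - g) = shift k f - shift k g.
Proof. exact: raddfB. Qed.

Lemma shiftZ k c f : shift k (c *: f) = c *: shift k f.
Proof. exact: mmapCZ. Qed.

Lemma shift_sum k (I : Type) (r : seq I) (F : I -> P) :
  shift k (\sum_(i <- r) F i) = \sum_(i <- r) shift k (F i).
Proof. exact: raddf_sum. Qed.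

Lemma shiftM k f g : shift k (f * g) = shift k f * shift k g.
Proof. exact: substM. Qed.

Lemma shiftU k m : shift k 'X[m] = 'X[shiftm k m].
Proof.
elim/cmonom_ind: m => [|[y j] m IH]; first by rewrite shiftm1 mono1; exact: subst1.
rewrite shiftmM shiftmU !monoM -IH shiftM; congr (_ * _).
by rewrite -!varE; exact: subst_var.
Qed.

Lemma shiftmD k l m : shiftm k (shiftm l m) = shiftm (k + l) m.
Proof.
elim/cmonom_ind: m => [|[y j] m IH]; first by rewrite !shiftm1.
by rewrite !shiftmM !shiftmU IH addnA.
Qed.

Lemma shiftm0 m : shiftm 0 m = m.
Proof.
elim/cmonom_ind: m => [|[y j] m IH]; first by rewrite !shiftm1.
by rewrite !shiftmM !shiftmU IH.
Qed.

Lemma shiftE k f : shift k f = \sum_(m <- msupp f) f@_m *: 'X[shiftm k m].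
Proof.
by rewrite {1}[f]malg_sum shift_sum; apply: eq_bigr => m _; rewrite shiftZ shiftU.
Qed.

Lemma shiftD k l f : shift k (shift l f) = shift (k + l) f.
Proof.
rewrite [shift l f]shiftE [RHS]shiftE shift_sum; apply: eq_bigr => m _.
by rewrite shiftZ shiftU shiftmD.
Qed.

Lemma shift0 f : shift 0 f = f.
Proof.
rewrite [RHS]malg_sum shiftE; apply: eq_bigr => m _; by rewrite shiftm0.
Qed.

Lemma prod_tvar a b : \prod_(a <= k < b) tvar K N k = 'X[tmon a (b - a)].
Proof.
move Ee : (b - a)%N => e; elim: e a Ee => [|e IH] a Ee.
  by rewrite big_geq ?mono1 //; lia.
rewrite big_ltn; last by lia.
by rewrite (IH a.+1) ?tmonS ?monoM -?varE //; lia.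
Qed.

Lemma psiM f g : psi (f * g) = psi f * psi g.
Proof. exact: substM. Qed.

Lemma psi1 : psi 1 = 1 :> P.
Proof. exact: subst1. Qed.

Lemma psi_tmon j (n : nat) : psi 'X[tmon j n] = 1 :> P.
Proof.
elim: n j => [|n IH] j; first by rewrite mono1 psi1.
rewrite tmonS monoM psiM [X in _ * X]IH mulr1 -varE; exact: subst_var.
Qed.

Lemma psi_Xword xs j (n : nat) :
  psi 'X[(Xword xs * tmon j n)%M] = 'X[Xword xs].
Proof.
rewrite monoM psiM [X in _ * X]psi_tmon mulr1 /Xword.
suff gen k : psi 'X[wordmon k (map some xs)] = 'X[wordmon k (map some xs)].
  exact: gen.
elim: xs k => [|x xs IH] k /=; first by rewrite mono1 psi1.
rewrite monoM psiM [X in _ * X]IH -varE; congr (_ * _); exact: subst_var.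
Qed.

(** * Letterplace spaces *)

Lemma embedU w : embed << FMonom w >> = 'X[wordmon 0 w].
Proof.
rewrite [LHS]mmapCU /=.
elim: w 0%N => [|y w IH] k /=; first by rewrite big_nil mono1.
by rewrite big_cons IH monoM -varE.
Qed.

Lemma embedE (a : Fbar K N) :
  embed a = \sum_(w <- msupp a) a@_w *: 'X[wordmon 0 w].
Proof.
apply: eq_bigr => w _; rewrite mul_malgC.
by rewrite -(fmK w) -embedU /embed mmapU /= mpolyC1E mul1r.
Qed.

Lemma Vbar_sum d (I : eqType) (r : seq I) (F : I -> P) :
  (forall i, i \in r -> Vbar d (F i)) -> Vbar d (\sum_(i <- r) F i).
Proof.
move=> VF; rewrite big_seq; apply: (big_ind (Vbar d)) => //.
  by exists 0; [move=> w; rewrite msupp0 | rewrite /embed mmap0].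
move=> _ _ [a ha ->] [b hb ->]; exists (a + b); last by rewrite /embed mmapD.
by move=> w /(fsubsetP (msuppD_le a b)); rewrite inE => /orP[/ha|/hb].
Qed.

Lemma VbarP d f : Vbar d f <-> (forall m, m \in msupp f -> mlin d m).
Proof.
split=> [[a ha ->] m|lin_f].
  rewrite -mcoeff_neq0 embedE raddf_sum /=; apply: contraNT => not_lin.
  rewrite big_seq big1 // => w wa; rewrite mcoeffZ mcoeff_mono.
  case: eqP => [Ew|_]; last by rewrite mulr0.
  by case/mlinP: not_lin; exists w => //; apply: ha.
rewrite [f]malg_sum; apply: Vbar_sum => m /lin_f/mlinP[w sw ->].
exists (f@_(wordmon 0 w) *: << FMonom w >>).
  move=> v /(fsubsetP (msuppZ_le _ _)); rewrite msuppU1 inE => /eqP->.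
  by rewrite -sw.
by rewrite -embedU [RHS]mmapCZ.
Qed.

Lemma tcommE (i : xvar N) : tcomm K i =
  'X[(ucm (None, 0%N) * ucm (Some i, 1%N))%M] -
  'X[(ucm (Some i, 0%N) * ucm (None, 1%N))%M].
Proof.
rewrite /tcomm /embed raddfB /=; congr (_ - _).
  rewrite /fvar malgM_def fgmulUU mulr1 [X in << _ *g X >>]fmmulE !fmuE.
  by rewrite [LHS]embedU /= mulm1.
rewrite /fvar malgM_def fgmulUU mulr1 [X in << _ *g X >>]fmmulE !fmuE.
by rewrite [LHS]embedU /= mulm1.
Qed.

Lemma shiftm_UU k (y z : xbar N) a b :
  shiftm k (ucm (y, a) * ucm (z, b))%M = (ucm (y, (k + a)%N) * ucm (z, (k + b)%N))%M.
Proof. by rewrite shiftmM; congr (_ * _)%M; exact: shiftmU. Qed.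

Lemma shift_tcomm k (i : xvar N) : shift k (tcomm K i) =
  'X[(ucm (None, k) * ucm (Some i, k.+1))%M] -
  'X[(ucm (Some i, k) * ucm (None, k.+1))%M].
Proof.
rewrite tcommE shiftB; congr (_ - _).
  by rewrite shiftU shiftm_UU addn0 addn1.
by rewrite shiftU shiftm_UU addn0 addn1.
Qed.

Lemma msupp_lincomb (I : eqType) (r : seq I) (c : I -> K) (F : I -> P) n :
  n \in msupp (\sum_(i <- r) c i *: F i) -> exists2 i, i \in r & n \in msupp (F i).
Proof.
rewrite -mcoeff_neq0 raddf_sum /= => nz.
have /hasP[i ir Fn] : has (fun i => n \in msupp (F i)) r; last by exists i.
apply: contraNT nz => /hasPn no_n; rewrite big_seq big1 // => i /no_n ne_in.
by rewrite mcoeffZ (mcoeff_outdom ne_in) mulr0.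
Qed.

Lemma msupp_sum_mono (I : eqType) (r : seq I) (c : I -> K) (phi : I -> mon) n :
  n \in msupp (\sum_(i <- r) c i *: 'X[phi i]) ->
  exists2 i, i \in r & n = phi i.
Proof.
by move=> /msupp_lincomb[i ir /msupp_mono_eq ->]; exists i.
Qed.

End Letterplace.

Local Notation "''X[' m ]" := (mono _ m) (at level 0, format "''X[' m ]").

(** * Multilinear elements of the saturation *)

Section Saturation.
Context (K : fieldType) (N : option nat).

Local Notation P := (Pbar K N).
Local Notation mon := {cmonom lpvar N}.
Implicit Types (f g h : P) (m n u : mon) (w : seq (xbar N)).

(** The projection onto the letterplace space of degree d. *)
Definition mlinpart (d : nat) : P -> P :=
  mmap malgC (fun m => if mlin d m then 'X[m] else 0).

Lemma mlinpartZ d c f : mlinpart d (c *: f) = c *: mlinpart d f.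
Proof. exact: mmapCZ. Qed.

Lemma mlinpart_sum d (I : Type) (r : seq I) (F : I -> P) :
  mlinpart d (\sum_(i <- r) F i) = \sum_(i <- r) mlinpart d (F i).
Proof. exact: raddf_sum. Qed.

Lemma mlinpartD d f g : mlinpart d (f + g) = mlinpart d f + mlinpart d g.
Proof. exact: raddfD. Qed.

Lemma mlinpart_id d f : Vbar d f -> mlinpart d f = f.
Proof.
move=> /VbarP lin_f; rewrite [RHS]malg_sum [LHS]mmapCE.
apply: eq_big_seq => m /lin_f lin_m.
by rewrite ifT.
Qed.

(** The letterplace spaces are multihomogeneous, so the projection keeps or kills a
    multihomogeneous element as a whole. *)
Lemma mlinpart_multihomog d g mu :
    (forall n, n \in msupp g -> multideg n = mu) ->
  mlinpart d g = if mu == multideg (tmon N 0 d) then g else 0.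
Proof.
move=> hom_g; rewrite /mlinpart mmapCE; case: ifP => Emu.
  rewrite [RHS]malg_sum; apply: eq_big_seq => n /hom_g mdn.
  by rewrite /mlin mdn Emu.
rewrite big_seq big1 // => n /hom_g mdn.
by rewrite /mlin mdn Emu scaler0.
Qed.

Lemma multideg_mono_shift c k m f n :
    Vbar c f -> n \in msupp ('X[m] * shift k f) ->
  multideg n = (multideg m * multideg (tmon N k c))%M.
Proof.
move=> /VbarP lin_f /msuppM_le[m1 [m2 [/msupp_mono_eq-> + ->]]].
rewrite shiftE => /msupp_sum_mono[m3 /lin_f/mlinP[w <- ->] ->].
by rewrite shiftm_wordmon addn0 multidegM multideg_wordmon.
Qed.

(** The elements of degree 0 are constants. *)
Lemma shift_Vbar0 k l f : Vbar 0 f -> shift k f = shift l f.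
Proof.
move=> /VbarP lin_f; rewrite [LHS]shiftE [RHS]shiftE.
apply: eq_big_seq => n /lin_f/mlinP[w /size0nil-> ->].
by rewrite !shiftm_wordmon.
Qed.

Section Ideal.
Variable J : P -> Prop.
Hypothesis J_ideal : is_Nideal J.

Lemma ideal0 : J 0. Proof. by case: J_ideal => -[]. Qed.
Lemma idealD f g : J f -> J g -> J (f + g).
Proof. by case: J_ideal => -[_ JD _] _; apply: JD. Qed.
Lemma idealMl f g : J g -> J (f * g).
Proof. by case: J_ideal => -[_ _ JM] _; apply: JM. Qed.
Lemma idealMr f g : J f -> J (f * g).
Proof. by rewrite mulrC; apply: idealMl. Qed.
Lemma ideal_shift k f : J f -> J (shift k f).
Proof. by case: J_ideal => _; apply. Qed.
Lemma idealZ c f : J f -> J (c *: f).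
Proof. by rewrite -mul_malgC; apply: idealMl. Qed.
Lemma ideal_sum (I : Type) (r : seq I) (F : I -> P) :
  (forall i, J (F i)) -> J (\sum_(i <- r) F i).
Proof. by move=> JF; apply: (big_ind J) => //; [exact: ideal0|exact: idealD]. Qed.

Lemma ideal_tmon_le d a b f :
  (a <= b)%N -> J ('X[tmon N d a] * f) -> J ('X[tmon N d b] * f).
Proof.
move=> /subnKC <- Jf; rewrite tmonD monoM [_ * 'X[_]]mulrC -mulrA.
exact: idealMl.
Qed.

Hypothesis tcommJ : forall i : xvar N, J (tcomm K i).

(** Passing from m to n inside J. Working with this implication, rather than with
    congruence modulo J, makes the exchange of letters a matter of monomials. *)
Definition ideal_step m n := forall h, J ('X[m] * h) -> J ('X[n] * h).

Lemma ideal_step_mull u m n : ideal_step m n -> ideal_step (u * m)%M (u * n)%M.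
Proof.
move=> mn h Jh; rewrite monoMA mulrCA; apply: mn.
by rewrite mulrCA -monoMA.
Qed.

Lemma ideal_step_mulr u m n : ideal_step m n -> ideal_step (m * u)%M (n * u)%M.
Proof. by move=> mn; rewrite (mulmC m) (mulmC n); apply: ideal_step_mull. Qed.

Lemma ideal_step_trans m n u : ideal_step m n -> ideal_step n u -> ideal_step m u.
Proof. by move=> mn nu h /mn/nu. Qed.

(** The generators of D exchange t with the letter that follows it. *)
Lemma ideal_step_swap (k : nat) (y : xbar N) :
  ideal_step (ucm (None, k) * ucm (y, k.+1))%M (ucm (y, k) * ucm (None, k.+1))%M.
Proof.
case: y => [i|//] h Jh.
have := idealMr h (ideal_shift k (tcommJ i)); rewrite shift_tcomm mulrBl.
move=> /(idealZ (-1)); rewrite scaleN1r opprB => /idealD/(_ Jh).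
by rewrite subrK.
Qed.

Lemma ideal_step_var k e (y : xbar N) :
  ideal_step (tmon N k e * ucm (y, (k + e)%N))%M (ucm (y, k) * tmon N k.+1 e)%M.
Proof.
elim: e k => [|e IH] k; first by rewrite addn0 mulmC.
apply: (@ideal_step_trans _ (ucm (None, k) * (ucm (y, k.+1) * tmon N k.+2 e))%M).
  by rewrite -mulmA -addSnnS; apply/ideal_step_mull/IH.
by rewrite tmonS !mulmA; apply/ideal_step_mulr/ideal_step_swap.
Qed.

(** A power of t is moved to the right of a word, letter by letter. *)
Lemma ideal_step_word k e w :
  ideal_step (tmon N k e * wordmon (k + e) w)%M
             (wordmon k w * tmon N (k + size w) e)%M.
Proof.
elim: w k => [|y w IH] k; first by rewrite addn0 mulmC.
apply: (@ideal_step_trans _ (ucm (y, k) * (tmon N k.+1 e * wordmon (k + e).+1 w))%M).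
  by rewrite /= !mulmA; apply/ideal_step_mulr/ideal_step_var.
by rewrite /= -mulmA addnS -addSn; apply/ideal_step_mull/IH.
Qed.

(** The heart of the description of the saturation. If the projection of m times a
    shift of f is not zero, then m completes the places of the shifted f to the
    interval from 0 to d, so m = u w for a word w that starts just after these
    places. The power of t on the right of w can be moved to the left of w, where
    it meets the shifted f and the product falls into J. If f is a constant, its
    shift can be placed anywhere, in particular just before the power of t. *)
Lemma ideal_mlinpart c d e k m f :
    Vbar c f -> J ('X[tmon N c e] * f) ->
  J ('X[tmon N d e] * mlinpart d ('X[m] * shift k f)).
Proof.
move=> Vf Jf.
have hom n := @multideg_mono_shift c k m f n Vf.
rewrite (mlinpart_multihomog d hom); case: ifP => [/eqP Emd|_]; last first.
  by rewrite mulr0; apply: ideal0.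
have mdj j : (multideg m j + (k <= j < k + c) = (j < d))%N.
  have := congr1 (fun a : {cmonom nat} => a j) Emd.
  by rewrite cmM !multideg_tmon.
have Jshift l : J ('X[tmon N (l + c) e] * shift l f).
  by rewrite -shiftm_tmon -shiftU -shiftM; apply: ideal_shift.
case: c => [|c] in Vf Jf hom Emd mdj Jshift *.
  have := Jshift d; rewrite addn0 (shift_Vbar0 d k Vf) => Jd.
  by rewrite mulrCA; apply: idealMl.
have [|u [w [sw ->]]] := @wordmon_dvd _ m (k + c.+1) (d - (k + c.+1)).
  by move=> j lej; have := mdj j; lia.
have Ed : d = (k + c.+1 + size w)%N by rewrite sw; have := mdj (k + c)%N; lia.
rewrite (monoMCA (tmon N d e)); apply: idealMl; rewrite {1}Ed.
apply: ideal_step_word; rewrite [X in 'X[X]]mulmC monoMA.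
by apply: idealMl; apply: Jshift.
Qed.

(** Membership in the saturation, tested on the letterplace projections of all
    multiples of all shifts. The quantification over h and k makes this an
    N-ideal by construction. *)
Definition mlin_saturated f := forall h k d,
  exists e, J ('X[tmon N d e] * mlinpart d (h * shift k f)).

Lemma mlin_saturated_Nideal : is_Nideal mlin_saturated.
Proof.
split; first split.
- move=> h k d; exists 0%N.
  by rewrite [shift k 0]mmap0 mulr0 [mlinpart d 0]mmap0 mulr0; apply: ideal0.
- move=> f g Qf Qg h k d.
  have [e1 J1] := Qf h k d; have [e2 J2] := Qg h k d; exists (maxn e1 e2).
  rewrite shift_add mulrDr mlinpartD mulrDr.
  by apply: idealD; [apply: ideal_tmon_le J1|apply: ideal_tmon_le J2];
    rewrite ?leq_maxl ?leq_maxr.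
- move=> f g Qg h k d; have [e Je] := Qg (h * shift k f) k d.
  by exists e; rewrite shiftM mulrA.
- move=> l f Qf h k d; have [e Je] := Qf h (k + l)%N d.
  by exists e; rewrite shiftD.
Qed.

Lemma generator_mlin_saturated c e f :
  Vbar c f -> J ('X[tmon N c e] * f) -> mlin_saturated f.
Proof.
move=> Vf Jf h k d; exists e.
rewrite [h]malg_sum mulr_suml mlinpart_sum mulr_sumr.
apply: ideal_sum => m; rewrite -scalerAl mlinpartZ -scalerAr.
by apply: idealZ; apply: ideal_mlinpart Jf.
Qed.

(** A multilinear element of the saturation itself satisfies the condition that is
    imposed on the generators of the saturation: it is its own projection. *)
Lemma SatL_Vbar d f :
  SatL J f -> Vbar d f -> exists e, J ('X[tmon N d e] * f).
Proof.
move=> Jf Vf; have Qf : mlin_saturated f.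
  apply: Jf mlin_saturated_Nideal _ => g [c [c' [Vg _]]].
  by rewrite prod_tvar; apply: generator_mlin_saturated.
have [e] := Qf 1 0%N d.
by rewrite mul1r shift0 mlinpart_id //; exists e.
Qed.

End Ideal.
End Saturation.

(** * The place ordering and leading monomials *)

Section PlaceOrder.
Context (N : option nat) (lt : rel {cmonom xbar N}).
Hypothesis lt_mo : monomial_ordering lt.

Local Notation mon := {cmonom lpvar N}.
Implicit Types (m n u : mon) (w : seq (xbar N)).

Lemma sliceE m j y : slice m j y = m (y, j).
Proof.
rewrite /slice cmE fsfunE; case: ifPn => // ym; apply/esym/eqP.
by rewrite cmE_eq0; apply: contra ym => ym; apply/imfsetP; exists (y, j).
Qed.

Lemma sliceM m n j : slice (m * n)%M j = (slice m j * slice n j)%M.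
Proof. by apply/eqP/cmP=> y; rewrite cmM !sliceE cmM. Qed.

Lemma slice1 j : slice (1 : mon)%M j = 1%M.
Proof. by apply/eqP/cmP=> y; rewrite sliceE !cm1. Qed.

Lemma slice_out m j : j \notin [fset v.2 | v in finsupp m] -> slice m j = 1%M.
Proof.
move=> jm; apply/eqP/cmP=> y; rewrite sliceE cm1; apply/eqP.
by rewrite cmE_eq0; apply: contra jm => ym; apply/imfsetP; exists (y, j).
Qed.

Lemma sliceU y j : slice (ucm (y, j) : mon) j = ucm y.
Proof. by apply/eqP/cmP=> z; rewrite sliceE !cmU xpair_eqE eqxx andbT. Qed.

Lemma sliceU_neq y j k : j != k -> slice (ucm (y, j) : mon) k = 1%M.
Proof.
by move=> ne_jk; apply/eqP/cmP=> z; rewrite sliceE cmU cm1 xpair_eqE (negbTE ne_jk) andbF.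
Qed.

Lemma slice_inj m n : (forall j, slice m j = slice n j) -> m = n.
Proof. by move=> eq_mn; apply/eqP/cmP=> -[y j]; rewrite -!sliceE eq_mn. Qed.

Lemma slice_wordmon k w j : (k + size w <= j)%N -> slice (wordmon k w) j = 1%M.
Proof.
elim: w k => [|y w IH] k /=; first by rewrite slice1.
by move=> le_j; rewrite sliceM sliceU_neq ?IH ?mul1m //; lia.
Qed.

Lemma slice_wordmon_rcons w y : slice (wordmon 0 (rcons w y)) (size w) = ucm y.
Proof.
by rewrite -cats1 wordmon_cat sliceM slice_wordmon //= sliceM slice1 sliceU mul1m mulm1.
Qed.

(** The places where both monomials are trivial contribute equal slices, hence the
    quantifiers need not be bounded. *)
Lemma place_ltP m n : reflect
  (exists2 j, lt (slice m j) (slice n j) &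
     forall k, (j < k)%N -> slice m k = slice n k)
  (place_lt lt m n).
Proof.
set places := [fset v.2 | v in finsupp m] `|` [fset v.2 | v in finsupp n].
have outE j : j \notin places -> slice m j = slice n j.
  by rewrite in_fsetU negb_or => /andP[jm jn]; rewrite !slice_out.
apply: (iffP hasP) => [[j _ /andP[lt_j /allP eq_j]]|[j lt_j eq_j]].
  exists j => // k lt_jk; have [kp|/outE//] := boolP (k \in places).
  by have /implyP/(_ lt_jk)/eqP := eq_j k kp.
exists j; last first.
  by rewrite lt_j; apply/allP => k _; apply/implyP => /eq_j->.
by apply: contraLR lt_j => /outE->; rewrite (mo_irr lt_mo).
Qed.

Lemma place_lt_irr : irreflexive (place_lt lt).
Proof. by move=> m; apply/place_ltP => -[j]; rewrite (mo_irr lt_mo). Qed.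

Lemma place_lt_trans : transitive (place_lt lt).
Proof.
move=> n m u /place_ltP[i lt_i eq_i] /place_ltP[j lt_j eq_j]; apply/place_ltP.
have [lt_ij|lt_ji|Eij] := ltngtP i j.
- exists j => [|k lt_jk]; first by rewrite eq_i.
  by rewrite eq_i ?eq_j // (ltn_trans lt_ij).
- exists i => [|k lt_ik]; first by rewrite -eq_j.
  by rewrite eq_i ?eq_j // (ltn_trans lt_ji).
- exists j => [|k lt_jk]; first by apply: (mo_trans lt_mo) lt_j; rewrite -Eij.
  by rewrite eq_i ?eq_j // Eij.
Qed.

Lemma place_lt_total m n : m != n -> place_lt lt m n || place_lt lt n m.
Proof.
move=> ne_mn; pose p j := slice m j != slice n j.
pose places := [fset v.2 | v in finsupp m] `|` [fset v.2 | v in finsupp n].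
have p_places j : p j -> j \in places.
  by apply: contraR; rewrite in_fsetU negb_or => /andP[jm jn]; rewrite !slice_out.
have ex_p : exists j, p j.
  have /hasP[j _ pj] : has p places; last by exists j.
  apply: contraNT ne_mn => /hasPn eq_mn; apply/eqP/slice_inj => j; apply/eqP.
  by apply: contraT => pj; have /negP := eq_mn j (p_places j pj).
have p_le j : p j -> (j <= \max_(k <- places) k)%N.
  by move=> /p_places jp; apply: leq_bigmax_seq.
have [j pj max_j] := ex_maxnP ex_p p_le.
have eq_k k : (j < k)%N -> slice m k = slice n k.
  by move=> lt_jk; apply/eqP; apply: contraLR lt_jk => /max_j; rewrite leqNgt.
have /orP[lt_mn|lt_nm] := mo_total lt_mo pj; apply/orP; [left|right];
  by apply/place_ltP; exists j => // k /eq_k.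
Qed.

(** Otherwise a < 1, and the powers of a would form an infinite descending sequence. *)
Lemma mo_lt1 (a : {cmonom xbar N}) : a != 1%M -> lt 1%M a.
Proof.
move=> a1; have /orP[lt_a1|//] := mo_total lt_mo a1.
have no_desc x : forall k, x = iter k (mmul a) 1%M -> False.
  elim/(well_founded_ind (mo_wf lt_mo)): x => x IH k Ex.
  apply: (IH (a * x)%M _ k.+1); last by rewrite Ex.
  by rewrite mulmC -[X in lt _ X](mulm1 x); apply: (mo_mul lt_mo).
by case: (no_desc 1%M 0%N).
Qed.

Lemma place_lt1 m : m != 1%M -> place_lt lt 1%M m.
Proof.
move=> m1; have := place_lt_total m1; case/orP=> // /place_ltP[j].
rewrite slice1; have [->|sj] := eqVneq (slice m j) 1%M; first by rewrite (mo_irr lt_mo).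
by move=> /(mo_trans lt_mo)/(_ (mo_lt1 sj)); rewrite (mo_irr lt_mo).
Qed.

Lemma place_lt_mul u m n : place_lt lt m n -> place_lt lt (u * m)%M (u * n)%M.
Proof.
move=> /place_ltP[j lt_j eq_j]; apply/place_ltP; exists j => [|k /eq_j].
  by rewrite !sliceM; apply: mo_mul.
by rewrite !sliceM => ->.
Qed.

Section LeadingMonomial.
Context (K : fieldType).
Local Notation P := (Pbar K N).
Implicit Types (f g h : P).

(** The trivial monomial that starts the fold is never returned by mistake, as it
    is the least one. *)
Lemma lmP f : f != 0 -> lm lt f \in msupp f /\
  (forall m, m \in msupp f -> m != lm lt f -> place_lt lt m (lm lt f)).
Proof.
rewrite -msupp_eq0 /lm => f0.
have: (msupp f : seq mon) != [::].
  apply: contraNneq f0 => f0; apply/eqP/fsetP => m; rewrite in_fset0.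
  by have -> : (m \in msupp f) = (m \in (msupp f : seq mon)) by []; rewrite f0.
have mem_f m : (m \in msupp f) = (m \in (msupp f : seq mon)) by [].
rewrite mem_f => s0; set r := foldr _ _ _.
have [r_le r_in] : (forall m, m \in (msupp f : seq mon) -> m != r -> place_lt lt m r)
    /\ (r = 1%M \/ r \in (msupp f : seq mon)).
  rewrite /r; elim: {r s0 mem_f f0}(msupp f : seq mon) => [|m s [IHle IHin]] /=.
    by split=> //; left.
  case: ifP => [lt_m|lt_m].
    split; last by right; rewrite inE eqxx.
    move=> n; rewrite inE => /orP[/eqP->|ns ne_nm]; first by rewrite eqxx.
    by have [->//|ne_nr] := eqVneq n
        (foldr (fun m n => if place_lt lt n m then m else n) 1%M s);
      apply: place_lt_trans lt_m; apply: IHle.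
  split; last by case: IHin => [->|IHin]; [left|right; rewrite inE IHin orbT].
  move=> n; rewrite inE => /orP[/eqP->|/IHle//] /place_lt_total.
  by rewrite lt_m orbF.
split; last by [].
case: r_in => // r1; case Es: (msupp f : seq mon) s0 r_le => [//|m s] _ r_le.
have [->|m1] := eqVneq r m; first by rewrite inE eqxx.
have := r_le m; rewrite inE eqxx eq_sym m1 => /(_ isT isT) lt_m1.
rewrite eq_sym r1 in m1; have := place_lt_trans lt_m1 ; rewrite r1 => /(_ _ (place_lt1 m1)).
by rewrite place_lt_irr.
Qed.

Lemma lm_uniq f m : m \in msupp f ->
  (forall n, n \in msupp f -> n != m -> place_lt lt n m) -> lm lt f = m.
Proof.
move=> fm max_m; have f0 : f != 0.
  by apply: contraTneq fm => ->; rewrite msupp0 in_fset0.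
have [lm_f lm_max] := lmP f0; apply/eqP; apply: contraT => ne_lm.
have lt1 := max_m _ lm_f ne_lm; rewrite eq_sym in ne_lm.
have lt2 := lm_max _ fm ne_lm.
by have := place_lt_trans lt1 lt2; rewrite place_lt_irr.
Qed.

Lemma mono_mulE u f : 'X[u] * f = \sum_(m <- msupp f) f@_m *: 'X[(u * m)%M].
Proof.
rewrite {1}[f]malg_sum mulr_sumr; apply: eq_bigr => m _.
by rewrite monoM scalerAr.
Qed.

Lemma mcoeff_mono_mul u f m : ('X[u] * f)@_(u * m)%M = f@_m.
Proof.
rewrite [f in RHS]malg_sum mono_mulE !raddf_sum /=; apply: eq_bigr => n _.
by rewrite !mcoeffZ !mcoeff_mono (inj_eq (@mulm_inj _ u)).
Qed.

Lemma lm_mono_mul u f : f != 0 -> lm lt ('X[u] * f) = (u * lm lt f)%M.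
Proof.
move=> f0; have [lm_f lm_max] := lmP f0; apply: lm_uniq.
  by rewrite -mcoeff_neq0 mcoeff_mono_mul mcoeff_neq0.
move=> n; rewrite mono_mulE => /msupp_sum_mono[m fm ->].
by rewrite (inj_eq (@mulm_inj _ u)) => /(lm_max _ fm); apply: place_lt_mul.
Qed.

Lemma mono_mul_neq0 u f : f != 0 -> 'X[u] * f != 0.
Proof.
move=> f0; have [lm_f _] := lmP f0; apply: contraTneq lm_f => uf0.
by rewrite -mcoeff_neq0 -(mcoeff_mono_mul u) uf0 mcoeff0 eqxx.
Qed.

Lemma lm_binomial a b : place_lt lt b a -> lm lt ('X[a] - 'X[b] : P) = a.
Proof.
move=> lt_ba; apply: lm_uniq => [|n /(fsubsetP (msuppB_le _ _))].
  have ne_ba : b != a by apply: contraTneq lt_ba => ->; rewrite place_lt_irr.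
  by rewrite -mcoeff_neq0 mcoeffB !mcoeff_mono eqxx (negbTE ne_ba) subr0 oner_eq0.
by rewrite in_fsetU; case/orP=> /msupp_mono_eq-> //; rewrite eqxx.
Qed.

(** At the last place t is smaller than x_i. *)
Lemma lm_tcomm (lt_var : var_increasing lt) (i : xvar N) :
  lm lt (tcomm K i) = (ucm (None, 0%N) * ucm (Some i, 1%N))%M.
Proof.
rewrite tcommE; apply: lm_binomial; apply/place_ltP; exists 1%N => [|k lt1k].
  rewrite !sliceM !sliceU !sliceU_neq // !mul1m.
  by case: lt_var.
by rewrite !sliceM !sliceU_neq //; lia.
Qed.

End LeadingMonomial.

(** Since t is smaller than every x_i, the last letter decides. *)
Lemma place_lt_rcons (lt_var : var_increasing lt) w w' x : size w = size w' ->
  place_lt lt (wordmon 0 (rcons w None)) (wordmon 0 (rcons w' (Some x))).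
Proof.
move=> sw; apply/place_ltP; exists (size w) => [|k lt_k].
  by rewrite slice_wordmon_rcons sw slice_wordmon_rcons; case: lt_var.
by rewrite !slice_wordmon ?size_rcons //; lia.
Qed.

End PlaceOrder.

(** * Normal forms modulo D and the operation star *)

Section NormalForms.
Context (K : fieldType) (N : option nat).
Local Notation P := (Pbar K N).
Local Notation mon := {cmonom lpvar N}.
Implicit Types (f g h : P) (m n u : mon) (w : seq (xbar N)) (xs : seq (xvar N)).

Lemma mdvd_trans m n u : mdvd m n -> mdvd n u -> mdvd m u.
Proof. by move=> /mdvdP mn /mdvdP nu; apply/mdvdP=> v; apply: leq_trans (nu v). Qed.

(** The normal words modulo D: letters of X, followed by t's up to the length d. *)
Definition padded d xs : mon := (Xword xs * tmon N (size xs) (d - size xs))%M.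

Lemma paddedE d xs :
  padded d xs = wordmon 0 (map some xs ++ nseq (d - size xs) None).
Proof. by rewrite wordmon_cat size_map. Qed.

Lemma padded_add d e xs : (size xs <= d <= e)%N ->
  padded e xs = (tmon N d (e - d) * padded d xs)%M.
Proof.
move=> le_xde; rewrite /padded (_ : (e - size xs) = (d - size xs) + (e - d))%N; last by lia.
rewrite tmonD subnKC; last by lia.
by rewrite mulmA mulmC.
Qed.

(** By induction from the right: t in front of a word that starts with a letter of
    X gives a forbidden factor. *)
Lemma normal_word k w :
    (forall j (i : xvar N),
      ~ mdvd (shiftm j (ucm (None, 0%N) * ucm (Some i, 1%N))%M) (wordmon k w)) ->
  exists xs r, w = map some xs ++ nseq r None.
Proof.
elim: w k => [|y w IH] k nf; first by exists [::], 0%N.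
have [|xs [r Ew]] := IH k.+1.
  move=> j i dvd_w; apply: (nf j i); apply: mdvd_trans dvd_w _.
  by exists (ucm (y, k)); rewrite mulmC.
case: y => [x|] in nf *; first by exists (x :: xs), r; rewrite Ew.
case: xs Ew => [|x xs] Ew; first by exists [::], r.+1; rewrite Ew.
case: (nf k x); exists (wordmon k.+2 (map some xs ++ nseq r None)).
by rewrite shiftm_UU addn0 addn1 Ew /= mulmA.
Qed.

Lemma normal_padded d g : Vbar d g -> normal_modD g ->
  forall m, m \in msupp g -> exists2 xs, (size xs <= d)%N & m = padded d xs.
Proof.
move=> /VbarP lin_g nf_g m gm; have /mlinP[w sw Em] := lin_g m gm.
have [|xs [r Ew]] := @normal_word 0 w; first by move=> j i; rewrite -Em; apply: nf_g.
have Er : r = (d - size xs)%N.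
  by rewrite -sw Ew size_cat size_map size_nseq addKn.
exists xs; first by rewrite -sw Ew size_cat size_map leq_addr.
by rewrite paddedE Em Ew Er.
Qed.

Lemma psiZ c f : psi (c *: f) = c *: psi f.
Proof. exact: mmapCZ. Qed.

Lemma psi_sum (I : Type) (r : seq I) (F : I -> P) :
  psi (\sum_(i <- r) F i) = \sum_(i <- r) psi (F i).
Proof. exact: raddf_sum. Qed.

Lemma psi_padded d xs : psi 'X[padded d xs] = 'X[Xword xs] :> P.
Proof. exact: psi_Xword. Qed.

(** The operation star with the maxima nu_k replaced by 1 at the places before d and
    by 0 after them. Unlike star it is linear in the polynomial. *)
Definition fillmon (d : nat) m : P :=
  'X[m] * \prod_(0 <= k < d) tvar K N k ^+ (1 - multideg m k).

Definition fill (d : nat) : P -> P := mmap malgC (fillmon d).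

Lemma fillE d f : fill d f = \sum_(m <- msupp f) f@_m *: fillmon d m.
Proof. exact: mmapCE. Qed.

Lemma fillZ d c f : fill d (c *: f) = c *: fill d f.
Proof. exact: mmapCZ. Qed.

Lemma fill_sum d (I : Type) (r : seq I) (F : I -> P) :
  fill d (\sum_(i <- r) F i) = \sum_(i <- r) fill d (F i).
Proof. exact: raddf_sum. Qed.

Lemma multideg_Xword xs k : multideg (Xword xs) k = (k < size xs)%N.
Proof. by rewrite /Xword multideg_wordmon multideg_tmon size_map. Qed.

Lemma fillmon_Xword d xs : (size xs <= d)%N ->
  fillmon d (Xword xs) = 'X[padded d xs].
Proof.
move=> le_xd; rewrite /fillmon /padded monoM; congr (_ * _).
rewrite (big_cat_nat (n := size xs)) //= big_nat big1 ?mul1r => [|k lt_k].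
  rewrite -prod_tvar; apply: eq_big_nat => k le_k.
  by rewrite multideg_Xword ltnNge; case/andP: le_k => ->.
by rewrite multideg_Xword; case/andP: lt_k => _ ->.
Qed.

(** For f = psi g with g in normal form, this is the common length of the words of
    star f. *)
Definition topdeg f : nat := (\max_(m <- msupp f) mdeg m)%N.

Lemma mdeg_Xword xs : mdeg (Xword xs) = size xs.
Proof. by rewrite mdeg_wordmon size_map. Qed.

Lemma leq_topdeg f m : m \in msupp f -> (mdeg m <= topdeg f)%N.
Proof. by move=> fm; apply: leq_bigmax_seq. Qed.

Lemma ltn_topdeg f k : (k < topdeg f)%N -> exists2 m, m \in msupp f & (k < mdeg m)%N.
Proof.
move=> lt_k; have /hasP[m fm lt_km] : has (fun m => k < mdeg m)%N (msupp f).
  apply: contraLR lt_k => /hasPn le_k; rewrite -leqNgt.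
  by apply/bigmax_leqP_seq => m fm _; rewrite leqNgt le_k.
by exists m.
Qed.

Lemma topdeg_mem f : f != 0 -> exists2 m, m \in msupp f & mdeg m = topdeg f.
Proof.
move=> f0; case Ed : (topdeg f) => [|d].
  have [m fm] : exists m, m \in msupp f by apply/fset0Pn; rewrite msupp_eq0.
  by exists m => //; apply/eqP; rewrite -leqn0 -Ed leq_topdeg.
have [|m fm lt_dm] := @ltn_topdeg f d; first by rewrite Ed.
by exists m => //; apply/eqP; rewrite eqn_leq lt_dm -Ed leq_topdeg.
Qed.

Definition in_X f := forall m, m \in msupp f -> exists xs, m = Xword xs.

Lemma multidegsP f mu :
  reflect (exists2 m, m \in msupp f & mu = multideg m) (mu \in multidegs f).
Proof. exact: imfsetP. Qed.

Lemma numax_in_X f k : in_X f -> numax f k = (k < topdeg f)%N.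
Proof.
move=> Xf; apply/eqP; rewrite eqn_leq; apply/andP; split.
  apply/bigmax_leqP_seq => _ /multidegsP[m fm ->] _; have [xs Em] := Xf m fm.
  rewrite Em multideg_Xword; have := leq_topdeg fm; rewrite Em mdeg_Xword.
  by lia.
case: ltnP => // /ltn_topdeg[m fm]; have [xs Em] := Xf m fm.
rewrite Em mdeg_Xword => lt_k.
apply: (@leq_trans (multideg m k)); first by rewrite Em multideg_Xword lt_k.
rewrite /numax; apply: (@leq_bigmax_seq _ _ _ (fun mu : {cmonom nat} => mu k)) => //.
by apply/multidegsP; exists m.
Qed.

(** In a sum of words of X of different lengths, a place occurs with exponent 1 in
    the longer words and is absent from the shorter ones; hence star adds t at
    the places up to the maximal length. *)
Lemma star_in_X f : in_X f -> star f = fill (topdeg f) f.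
Proof.
move=> Xf; rewrite /star.
transitivity (\sum_(mu <- multidegs f) \sum_(m <- msupp f | multideg m == mu)
    f@_m *: fillmon (topdeg f) m).
  apply: eq_bigr => mu _; rewrite /mhcomp mulr_suml; apply: eq_bigr => m /eqP <-.
  rewrite malgU_scale -scalerAl /fillmon; congr (_ *: (_ * _)).
  rewrite (perm_big (index_iota 0 (topdeg f))) /=; last first.
    apply: uniq_perm; [exact: fset_uniq|exact: iota_uniq|] => k.
    rewrite mem_index_iota /=; apply/bigfcupP/idP.
      case=> _ /andP[/multidegsP[n fn ->] _]; rewrite -cmE_neq0.
      have [xs En] := Xf n fn; rewrite En multideg_Xword => lt_k.
      by have := leq_topdeg fn; rewrite En mdeg_Xword; lia.
    case/ltn_topdeg=> n fn lt_k; exists (multideg n).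
      by rewrite andbT; apply/multidegsP; exists n.
    have [xs En] := Xf n fn; rewrite -cmE_neq0 En multideg_Xword.
    by rewrite En mdeg_Xword in lt_k; rewrite lt_k.
  by apply: eq_big_nat => k /andP[_ lt_k]; rewrite numax_in_X // lt_k.
rewrite (exchange_big_dep xpredT) //= fillE; apply: eq_big_seq => m fm.
under eq_bigl do rewrite eq_sym.
rewrite -big_filter (filter_pred1_uniq (fset_uniq _)) ?big_seq1 //.
by apply/multidegsP; exists m.
Qed.

Lemma psi_in_X d g : Vbar d g -> normal_modD g ->
  forall m, m \in msupp (psi g) -> exists2 xs, (size xs <= d)%N & m = Xword xs.
Proof.
move=> Vg nf_g m; rewrite {1}[g]malg_sum psi_sum.
under eq_bigr do rewrite psiZ.
case/msupp_lincomb=> n /(normal_padded Vg nf_g)[xs le_xd ->].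
by rewrite psi_padded => /msupp_mono_eq->; exists xs.
Qed.

Lemma fill_psi d g : Vbar d g -> normal_modD g -> fill d (psi g) = g.
Proof.
move=> Vg nf_g; rewrite [RHS]malg_sum {1}[g]malg_sum psi_sum fill_sum.
apply: eq_big_seq => m /(normal_padded Vg nf_g)[xs le_xd ->].
rewrite psiZ fillZ psi_padded [fill d _]mmapC_mono; congr (_ *: _).
exact: fillmon_Xword.
Qed.

Lemma fill_add d e f : (d <= e)%N -> in_X f -> (topdeg f <= d)%N ->
  fill e f = 'X[tmon N d (e - d)] * fill d f.
Proof.
move=> le_de Xf top_d; rewrite !fillE mulr_sumr; apply: eq_big_seq => m fm.
have [xs Em] := Xf m fm; have := leq_topdeg fm; rewrite Em mdeg_Xword => le_x.
rewrite -scalerAr !fillmon_Xword; try lia.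
by rewrite -monoM -padded_add //; lia.
Qed.

Lemma fill_supp d f m : in_X f -> (topdeg f <= d)%N -> m \in msupp (fill d f) ->
  exists xs, [/\ (size xs <= d)%N, m = padded d xs & Xword xs \in msupp f].
Proof.
move=> Xf top_d; rewrite fillE => /msupp_lincomb[n fn].
have [xs En] := Xf n fn; have := leq_topdeg fn; rewrite En mdeg_Xword => le_x.
rewrite fillmon_Xword; last by lia.
by move/msupp_mono_eq->; exists xs; split; rewrite -?En //; lia.
Qed.

Lemma psi_fill d f : in_X f -> (topdeg f <= d)%N -> psi (fill d f) = f.
Proof.
move=> Xf top_d; rewrite fillE psi_sum [RHS]malg_sum; apply: eq_big_seq => m fm.
have [xs Em] := Xf m fm; have := leq_topdeg fm; rewrite Em mdeg_Xword => le_x.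
by rewrite psiZ fillmon_Xword ?psi_padded //; lia.
Qed.

(** For g in normal form, star (psi g) is g with the t's common to all its words
    removed. As no t is common to what remains, some word of it lies in X. *)
Lemma star_psi_normal d g (s := star (psi g)) : Vbar d g -> normal_modD g ->
  exists c, [/\ (c <= d)%N, g = 'X[tmon N c (d - c)] * s,
    forall m, m \in msupp s -> exists2 xs, (size xs <= c)%N & m = padded c xs
    & s != 0 -> exists2 xs, size xs = c & Xword xs \in msupp s].
Proof.
move=> Vg nf_g; set f := psi g.
have Xf_d m : m \in msupp f -> exists2 xs, (size xs <= d)%N & m = Xword xs.
  exact: psi_in_X.
have Xf : in_X f by move=> m /Xf_d[xs _ ->]; exists xs.
have top_d : (topdeg f <= d)%N.
  by apply/bigmax_leqP_seq => m /Xf_d[xs le_x ->] _; rewrite mdeg_Xword.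
have Es : s = fill (topdeg f) f by apply: star_in_X.
exists (topdeg f); split=> //.
- rewrite Es -(fill_add top_d Xf (leqnn _)).
  exact/esym/fill_psi.
- by move=> m; rewrite Es => /fill_supp[] // xs [le_x Em _]; exists xs.
move=> s0; have f0 : f != 0.
  by apply: contraNneq s0 => f0; rewrite Es f0 [fill _ _]mmap0.
have [m fm Em] := topdeg_mem f0; have [xs Ex] := Xf m fm.
have sx : size xs = topdeg f by rewrite -Em Ex mdeg_Xword.
exists xs => //; move: fm; rewrite -{1}(@psi_fill (topdeg f) f) // -Es Ex.
rewrite [s]malg_sum psi_sum.
under eq_bigr do rewrite psiZ.
case/msupp_lincomb=> n sn; have := sn; rewrite {1}Es => /fill_supp[] // ys [le_y En _].
rewrite {1}En psi_padded => /msupp_mono_eq Exy.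
have sy : size ys = topdeg f by rewrite -sx -!mdeg_Xword Exy.
by rewrite -malg_sum Exy; move: sn; rewrite En /padded sy subnn mulm1.
Qed.

End NormalForms.

(** * Leading monomials after saturation *)

Section Main.
Context (K : fieldType) (N : option nat).
Local Notation P := (Pbar K N).
Local Notation mon := {cmonom lpvar N}.
Implicit Types (f g h : P) (m n u : mon) (w : seq (xbar N)) (xs : seq (xvar N)).

Lemma Ngen_incl (S : P -> Prop) f : S f -> Ngen S f.
Proof. by move=> Sf J _; apply. Qed.

Lemma Vbar_padded c f :
    (forall m, m \in msupp f -> exists2 xs, (size xs <= c)%N & m = padded c xs) ->
  Vbar c f.
Proof.
move=> f_padded; apply/VbarP => m /f_padded[xs le_x ->]; apply/mlinP.
rewrite paddedE; eexists; last by [].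
by rewrite size_cat size_map size_nseq subnKC.
Qed.

Lemma Vbar_tcomm (i : xvar N) : Vbar 2 (tcomm K i).
Proof.
apply/VbarP => m; rewrite tcommE => /(fsubsetP (msuppB_le _ _)).
rewrite in_fsetU => /orP[] /msupp_mono_eq ->; apply/mlinP.
  by exists [:: None; Some i]; rewrite //= mulm1.
by exists [:: Some i; None]; rewrite //= mulm1.
Qed.

Lemma shiftm_Xword i xs : shiftm i (Xword xs) = wordmon i (map some xs).
Proof. by rewrite shiftm_wordmon addn0. Qed.

(** Divisibility by a word of X only tests the exponents of letters of X, and
    these do not change when t's are inserted in the multiple. *)
Lemma mdvd_Xword_cancel i xs u a e m :
  mdvd (shiftm i (u * Xword xs)%M) (tmon N a e * m)%M ->
  mdvd (shiftm i (Xword xs)) m.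
Proof.
rewrite shiftmM => /mdvdP dvd_m; apply/mdvdP=> -[[x|] j].
  have := dvd_m (Some x, j); rewrite !cmM tmon_Some add0n.
  by apply: leq_trans; apply: leq_addl.
rewrite shiftm_Xword wordmonE; case: (i <= j)%N => //=.
by elim: (j - i)%N xs {dvd_m} => [|k IH] [|x xs] //=.
Qed.

(** The t's appended to a word come after all its letters of X, so they create no
    new factor t x_i. *)
Lemma mdvd_tx_cancel k (i : xvar N) d e m : mlin d m ->
  mdvd (shiftm k (ucm (None, 0%N) * ucm (Some i, 1%N))%M) (tmon N d e * m)%M ->
  mdvd (shiftm k (ucm (None, 0%N) * ucm (Some i, 1%N))%M) m.
Proof.
move=> /mlinP[w sw Em]; rewrite shiftm_UU addn0 addn1 => /mdvdP dvd_m.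
apply/mdvdP=> -[[x|] j].
  by have := dvd_m (Some x, j); rewrite [leqRHS]cmM tmon_Some.
have := dvd_m (None, j); rewrite !cmM !cmU !xpair_eqE /= addn0; have [<-|//] := eqVneq k j.
suff -> : tmon N d e (None, k) = 0%N by [].
have : (0 < m (Some i, k.+1))%N.
  have := dvd_m (Some i, k.+1); rewrite !cmM tmon_Some add0n => /(leq_trans _)->//.
  by rewrite !cmU eqxx addn1.
have [lt_k _|le_k] := ltnP k.+1 d; last first.
  by rewrite Em wordmonE subn0 drop_oversize // sw.
by rewrite /tmon wordmonE leqNgt ltnW.
Qed.

Lemma star_psi_SatL (J : P -> Prop) d g : J g -> Vbar d g -> normal_modD g ->
  [/\ SatL J (star (psi g)), Lbar (star (psi g)) & normal_modD (star (psi g))].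
Proof.
move=> Jg Vg nf_g; have [c [le_cd Eg s_padded _]] := star_psi_normal Vg nf_g.
have Vs := Vbar_padded s_padded; split; last 2 first.
- by exists c.
- move=> m sm k i dvd_m; apply: (nf_g (tmon N c (d - c) * m)%M _ k i).
    by rewrite Eg -mcoeff_neq0 mcoeff_mono_mul mcoeff_neq0.
  by apply: mdvd_trans dvd_m _; exists (tmon N c (d - c)); rewrite mulmC.
by apply: Ngen_incl; exists c, d; rewrite prod_tvar -Eg.
Qed.

Section Groebner.
Variables (lt : rel {cmonom xbar N}).
Hypotheses (lt_mo : monomial_ordering lt) (lt_var : var_increasing lt).

(** A word of X of the full length c beats every word that ends with t, so the
    leading word lies in X. *)
Lemma lm_padded c f : f != 0 ->
    (forall m, m \in msupp f -> exists2 xs, (size xs <= c)%N & m = padded c xs) ->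
    (exists2 xs, size xs = c & Xword xs \in msupp f) ->
  exists xs, lm lt f = Xword xs.
Proof.
move=> f0 f_padded [ys sy fy]; have [lm_f lm_max] := lmP lt_mo f0.
have [xs le_x E] := f_padded _ lm_f; exists xs; rewrite E.
have [sx|ne_x] := eqVneq (size xs) c; first by rewrite /padded sx subnn mulm1.
case/lastP: ys sy fy => [|ys y] sy fy; first by rewrite /= in sy; lia.
have lt_lm : place_lt lt (lm lt f) (Xword (rcons ys y)).
  rewrite E paddedE /Xword map_rcons.
  rewrite (_ : (c - size xs) = (c - size xs).-1 + 1)%N; last by lia.
  rewrite nseqD catA cats1; apply: place_lt_rcons => //.
  rewrite size_cat !size_map size_nseq.
  by move: sy; rewrite size_rcons; lia.
have [Ey|ne_y] := eqVneq (Xword (rcons ys y)) (lm lt f).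
  by rewrite Ey place_lt_irr in lt_lm.
have := place_lt_trans lt_mo lt_lm (lm_max _ fy ne_y).
by rewrite place_lt_irr.
Qed.

End Groebner.
End Main.

Theorem theorem5p9 (K : fieldType) (N : option nat)
    (lt : rel {cmonom xbar N})
    (lt_mo : monomial_ordering lt) (lt_var : var_increasing lt)
    (J : Pbar K N -> Prop)
    (J_L : is_Lideal J) (DJ : forall f, D f -> J f)
    (G : Pbar K N -> Prop) (G_gb : is_groebner_modD lt J G) :
  is_groebner_modD lt (SatL J)
    (fun h => exists2 g, G g & h = star (psi g)).
Proof.
case: J_L G_gb => [J_ideal _] [G_nf [_ G_gb]].
have tcommJ i : J (tcomm K i) by apply: DJ; apply: Ngen_incl; exists i.
have G'P g : G g -> [/\ SatL J (star (psi g)), Lbar (star (psi g)) &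
    normal_modD (star (psi g))].
  by move=> /G_nf[Jg [d Vg] nf_g]; apply: star_psi_SatL Vg nf_g.
split; first by move=> _ [g Gg ->]; apply: G'P.
split=> [_ [[g Gg ->]|[i ->]]|f Jf [d Vf] f0].
- by have [] := G'P g Gg.
- split; last by exists 2%N; apply: Vbar_tcomm.
  apply: Ngen_incl; exists 2%N, 2%N; split=> //; first exact: Vbar_tcomm.
  by rewrite big_geq // mul1r.
(* Multiplying f by the t's at the places after d brings it into J. *)
have [e Jtf] := SatL_Vbar J_ideal tcommJ Jf Vf.
have Vtf : Vbar (d + e) ('X[tmon N d e] * f).
  move: Vf => /VbarP lin_f; apply/VbarP => m.
  rewrite mono_mulE => /msupp_sum_mono[n /lin_f/mlinP[w sw ->] ->].
  apply/mlinP; exists (w ++ nseq e None); first by rewrite size_cat size_nseq sw.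
  by rewrite wordmon_cat sw mulmC.
have Ltf : Lbar ('X[tmon N d e] * f) by exists (d + e)%N.
have [g [i [Gg g0]]] := G_gb _ Jtf Ltf (mono_mul_neq0 lt_mo _ f0).
rewrite lm_mono_mul // => dvd_g.
case: Gg => [Gg|[x Eg]]; last first.
  exists g, i; split=> //; first by right; exists x.
  rewrite Eg lm_tcomm // in dvd_g *; apply: mdvd_tx_cancel dvd_g.
  by have [lm_f _] := lmP lt_mo f0; move/VbarP: Vf; apply.
have [_ [dg Vg] nf_g] := G_nf g Gg.
have [c [le_cd Eg s_padded s_top]] := star_psi_normal Vg nf_g.
have s0 : star (psi g) != 0.
  by apply: contraNneq g0 => s0; rewrite Eg s0 mulr0.
exists (star (psi g)), i; split=> //; first by left; exists g.
have [xs Es] := lm_padded lt_mo lt_var s0 s_padded (s_top s0).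
move: dvd_g; rewrite {1}Eg lm_mono_mul // Es; exact: mdvd_Xword_cancel.
Qed.
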